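(* Let $n\ge 23$ and $4\le k\le n-2$ be integers and let $G\in\mathscr{Q}(n,k)$ with $G\not\cong Q_{n,k}$ and $G\not\cong Q^*_{n,k}$. Then $$SO(G)\le (k-2)\sqrt{k^2+4}+(k-3)\sqrt{(n-2)^2+4}+(n-k-1)\sqrt{(n-2)^2+1}+\sqrt{k^2+(n-2)^2}+\sqrt{(n-2)^2+9}+\sqrt{k^2+9}+\sqrt{13},$$ with equality if and only if $G\cong Q'_{n,k}$.
   Context: All graphs are finite, simple and undirected; $d_G(v)$ is the degree of $v$ in $G$, and an $i$-vertex is a vertex of degree $i$. The Sombor index is $SO(G)=\sum_{uv\in E(G)}\sqrt{d_G(u)^2+d_G(v)^2}$. A connected graph $G$ is a quasi-tree if there is $u\in V(G)$ such that $G-u$ is a tree. $\mathscr{Q}(n,k)$ is the set of quasi-tree graphs $G$ of order $n$ having a vertex $u$ such that $G-u$ is a tree and $d_G(u)=k$. $S_m\cong K_{1,m-1}$ is the star of order $m$. $Q_{n,k}$ is obtained from $S_{n-1}$ and a new vertex $v$ by joining $v$ to the center of $S_{n-1}$ and to $k-1$ leaves of $S_{n-1}$. $Q^*_{n,k}$ ($1\le k\le n-2$) is obtained from $S_{n-1}$ and a new vertex $v$ by joining $v$ to $k$ leaves of $S_{n-1}$ (and not to the center). For $3\le k\le n-1$, $Q'_{n,k}$ is obtained from $Q_{n-1,k-1}$ by adding a new vertex joined to exactly two vertices: one $2$-vertex of $Q_{n-1,k-1}$ and the $(k-1)$-vertex $v$ (the vertex added to the star in the construction of $Q_{n-1,k-1}$).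 *)

(* Defs.v *)
From HB Require Import structures.
From mathcomp Require Import all_boot all_order all_algebra.

Set Implicit Arguments.
Unset Strict Implicit.
Unset Printing Implicit Defensive.

Import Order.TTheory GRing.Theory Num.Theory.
Local Open Scope ring_scope.

Record sgraph := SGraph {
  vertex :> finType;
  adj : rel vertex;
  adj_sym : symmetric adj;
  adj_irr : irreflexive adj
}.

Definition isomorphic (G H : sgraph) : Prop :=
  exists2 f : G -> H, bijective f & forall x y : G, adj (f x) (f y) = adj x y.

Definition degree (G : sgraph) (v : G) : nat := #|[set w : G | adj v w]|.

Definition edges (G : sgraph) : {set {set G}} :=
  [set [set p.1; p.2] | p : G * G & adj p.1 p.2].

(* An edge is a two-element set [set u; v], so the inner sum is
   d(u)^2 + d(v)^2. *)
Definition sombor (R : rcfType) (G : sgraph) : R :=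
  \sum_(e in edges G) Num.sqrt (\sum_(x in e) (degree x)%:R ^+ 2).

Definition connected_graph (G : sgraph) : Prop :=
  (0 < #|G|)%N /\ forall x y : G, connect (@adj G) x y.

(* [ucycle] also accepts sequences of size 0 and 2, which are not graph
   cycles. *)
Definition acyclic_graph (G : sgraph) : Prop :=
  forall s : seq G, (2 < size s)%N -> ~ ucycle (@adj G) s.

Definition is_tree (G : sgraph) : Prop := connected_graph G /\ acyclic_graph G.

Section DeleteVertex.
Variables (G : sgraph) (u : G).

Definition delete_adj : rel {x : G | x != u} :=
  fun x y => adj (val x) (val y).

Lemma delete_adj_sym : symmetric delete_adj.
Proof. by move=> x y; apply: adj_sym. Qed.

Lemma delete_adj_irr : irreflexive delete_adj.
Proof. by move=> x; apply: adj_irr. Qed.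

Definition delete_vertex : sgraph := SGraph delete_adj_sym delete_adj_irr.
End DeleteVertex.

Definition quasi_tree (G : sgraph) : Prop :=
  connected_graph G /\ exists u : G, is_tree (delete_vertex u).

Definition in_Q (n k : nat) (G : sgraph) : Prop :=
  [/\ quasi_tree G, #|G| = n &
      exists u : G, is_tree (delete_vertex u) /\ degree u = k].

(* The new vertex is [None]; its neighbourhood is A. *)
Section AddVertex.
Variables (G : sgraph) (A : {set G}).

Definition add_adj : rel (option G) := fun x y =>
  match x, y with
  | Some a, Some b => adj a b
  | Some a, None => a \in A
  | None, Some b => b \in A
  | None, None => false
  end.

Lemma add_adj_sym : symmetric add_adj.
Proof. by move=> [a|] [b|] //=; apply: adj_sym. Qed.

Lemma add_adj_irr : irreflexive add_adj.
Proof. by move=> [a|] //=; apply: adj_irr. Qed.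

Definition add_vertex : sgraph := SGraph add_adj_sym add_adj_irr.
End AddVertex.

(* The center is the vertex 0; the leaves are 1, ..., m - 1. *)
Section Star.
Variable m : nat.

Definition star_adj : rel 'I_m :=
  fun i j => (nat_of_ord i == 0%N) != (nat_of_ord j == 0%N).

Lemma star_adj_sym : symmetric star_adj.
Proof. by move=> i j; rewrite /star_adj eq_sym. Qed.

Lemma star_adj_irr : irreflexive star_adj.
Proof. by move=> i; rewrite /star_adj eqxx. Qed.

Definition star : sgraph := SGraph star_adj_sym star_adj_irr.
End Star.

(* Joined to the center 0 and to the k - 1 leaves 1, ..., k - 1
   (for 1 <= k <= n - 1). *)
Definition Qgraph (n k : nat) : sgraph :=
  @add_vertex (star (n - 1)) [set i : 'I_(n - 1) | (i < k)%N].

(* Joined to the k leaves 1, ..., k (for 1 <= k <= n - 2). *)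
Definition Qstar (n k : nat) : sgraph :=
  @add_vertex (star (n - 1)) [set i : 'I_(n - 1) | (0 < i <= k)%N].

(* In [Qgraph (n - 1) (k - 1)] the (k - 1)-vertex v is [None], and the leaf
   [Some 1] is a 2-vertex, adjacent to the center and to v
   (for 3 <= k <= n - 1). *)
Definition Qprime (n k : nat) : sgraph :=
  @add_vertex (Qgraph (n - 1) (k - 1))
    [set x : option 'I_(n - 1 - 1) |
       if x is Some i then nat_of_ord i == 1%N else true].

(* Main.v *)
Require Import Defs.
From HB Require Import structures.
From mathcomp Require Import all_boot all_order all_algebra.
From mathcomp Require Import zify ring lra.

Set Implicit Arguments.
Unset Strict Implicit.
Unset Printing Implicit Defensive.

Import Order.TTheory GRing.Theory Num.Theory.
Local Open Scope ring_scope.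

(** Let T = G - u, a tree of order n - 1, and let a(v) be the degree of v in T.
    If no vertex has a(v) >= n - 3, crude bounds suffice: an edge vw of T
    contributes at most a(v) + a(w) + 2/3 and an edge uv at most
    sqrt (k^2 + 4) + (a(v) - 1), while the sum of the a(v)^2 is smaller than in
    the extremal graph by an amount linear in n.  If some a(c) = n - 2, then T is
    a star and G is one of the two excluded graphs.  If a(c) = n - 3, then T is a
    star with center c together with a pendant vertex y attached to a leaf x, and
    G is determined by which of c, x, y are adjacent to u.  Trading an ordinary
    leaf adjacent to u for any of c, x, y strictly increases the index, so the
    maximum is reached only when all three are adjacent to u. *)

(** * The Sombor index as a sum over directed edges *)

Definition hypot (R : rcfType) (a b : nat) : R := Num.sqrt (a%:R ^+ 2 + b%:R ^+ 2).

(** Each edge [[set a; b]] arises from exactly two ordered pairs, [(a, b)] and [(b, a)]. Doubling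
    the index makes it a sum over vertices and their neighbours without a choice of direction. *)
Lemma sombor_double (R : rcfType) (G : sgraph) :
  \sum_(v : G) \sum_(w | adj v w) hypot R (degree v) (degree w) = sombor R G *+ 2.
Proof.
rewrite pair_big_dep /= (partition_big (fun p => [set p.1; p.2]) (mem (edges G))) /=; last first.
  by move=> p adjp; apply: imset_f; rewrite inE.
rewrite /sombor -sumrMnl; apply: eq_bigr => e /imsetP[[a b]]; rewrite inE /= => ab ->.
have nab : a != b by apply: contraTneq ab => ->; rewrite adj_irr.
have nba : b != a by rewrite eq_sym.
rewrite (bigD1 (a, b)) /= ?ab ?eqxx // (bigD1 (b, a)) /=; last first.
  by rewrite adj_sym ab setUC eqxx xpair_eqE negb_and nba.
rewrite big_pred0 ?addr0 => [|[c d] /=].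
  rewrite big_setU1 ?inE //= big_set1 /hypot mulr2n; congr (_ + _).
  by rewrite addrC.
apply/negbTE; apply/negP => /andP[/andP[/andP[cd /eqP E] n1] n2].
have : c \in [set a; b] by rewrite -E !inE eqxx.
have : d \in [set a; b] by rewrite -E !inE eqxx orbT.
rewrite !inE => /orP[]/eqP ? /orP[]/eqP ?; subst;
  by rewrite ?adj_irr ?eqxx in cd n1 n2.
Qed.

Lemma sombor_iso (R : rcfType) (G H : sgraph) :
  isomorphic G H -> sombor R G = sombor R H.
Proof.
case=> f bij_f adj_f.
have deg_f x : degree (f x) = degree x.
  rewrite /degree -(card_imset _ (bij_inj bij_f)); congr #|pred_of_set _|.
  apply/setP => y; rewrite inE; case: bij_f => g fK gK.
  by rewrite -(gK y) adj_f mem_imset ?inE //; apply: can_inj fK.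
apply/eqP; rewrite -[_ == _](eqrMn2r 2) -!sombor_double; apply/eqP.
rewrite [RHS](reindex f) /=; last by apply: onW_bij.
apply: eq_bigr => v _; rewrite [RHS](reindex f) /=; last by apply: onW_bij.
by apply: eq_big => [w|w _]; rewrite ?adj_f ?deg_f.
Qed.

(** With one direction chosen per edge, out-neighbours and in-neighbours contribute the same total,
    so the factor 2 cancels. This serves the exact computation for brooms. *)
Lemma sombor_orientation (R : rcfType) (G : sgraph) (o : rel G) :
  (forall v w, adj v w = o v w || o w v) -> (forall v w, o v w -> ~~ o w v) ->
  sombor R G = \sum_(v : G) \sum_(w | o v w) hypot R (degree v) (degree w).
Proof.
move=> adjE anti; apply/eqP; rewrite -[_ == _](eqrMn2r 2) -sombor_double.
have -> : (\sum_(v : G) \sum_(w | o v w) hypot R (degree v) (degree w)) *+ 2 =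
    \sum_(v : G) \sum_(w | o v w) hypot R (degree v) (degree w) +
    \sum_(v : G) \sum_(w | o w v) hypot R (degree v) (degree w).
  rewrite mulr2n; congr (_ + _); rewrite [RHS](exchange_big_dep predT) //=.
  by apply: eq_bigr => v _; apply: eq_bigr => w _; rewrite /hypot addrC.
rewrite -big_split /=; apply/eqP/eq_bigr => v _.
rewrite (bigID (o v)) /=; congr (_ + _); apply: eq_bigl => w; rewrite adjE.
  by case: (o v w); rewrite /= ?andbF.
by case: (boolP (o w v)) => [/anti->|_] //=; rewrite ?orbF ?andbN ?orbT.
Qed.

(** * Degrees in forests and in connected graphs *)

Lemma acyclic_leaf (G : sgraph) (S : {set G}) :
  acyclic_graph G -> S != set0 ->
  exists2 v, v \in S & (#|[set w in S | adj v w]| <= 1)%N.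
Proof.
(* Otherwise every path in [S] could be prolonged, a repeated vertex closing a
   cycle. *)
move=> acyc /set0Pn[z zS].
case: (boolP [exists v in S, (#|[set w in S | adj v w]| <= 1)%N]).
  by case/exists_inP=> v vS v1; exists v.
move=> /exists_inPn /= noleaf; exfalso.
suff long l : exists x p, [/\ size p = l, path (@adj G) x p, uniq (x :: p) & {subset x :: p <= S}].
  have [x [p [sp _ up _]]] := long #|G|.
  by have := max_card (mem (x :: p)); rewrite (card_uniqP up) /= sp ltnn.
elim: l => [|l [x [p [sp px up pS]]]].
  by exists z, [::]; split=> // y; rewrite inE => /eqP->.
have xS : x \in S by apply: pS; rewrite mem_head.
(* [head x p] is the vertex after [x] on the path, or [x] itself if [p] is empty. A neighbour [y]
   different from it cannot close a cycle of length 2: if [y] lies on [p], at least one vertex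
   separates it from [x]. *)
have : (0 < #|[set w in S | adj x w] :\ head x p|)%N.
  by have := noleaf x xS; rewrite (cardsD1 (head x p)); case: (_ \in _) => /=; lia.
case/card_gt0P=> y; rewrite !inE => /and3P[yh yS xy].
have nyx : y != x by apply: contraTneq xy => ->; rewrite adj_irr.
case: (boolP (y \in p)) => [yp|nyp]; last first.
  exists y, (x :: p); split=> //=; first by rewrite sp.
  - by rewrite adj_sym xy.
  - by rewrite inE negb_or nyx nyp.
  - by move=> t; rewrite inE => /orP[/eqP->|/pS].
case/splitPr: yp yh px up {pS sp} => p1 p2; case: p1 => [|q p1] yh; first by rewrite eqxx in yh.
rewrite -cat_rcons cat_path => /andP[px _]; rewrite -cat_cons cat_uniq => /andP[up _].
case: (acyc (x :: rcons (q :: p1) y)); first by rewrite /= size_rcons.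
by rewrite /ucycle up andbT /cycle rcons_path px last_rcons adj_sym.
Qed.

(** A forest on [S] has at most [#|S| - 1] edges: deleting a vertex with at most one neighbour in
    [S] lowers the degree sum by at most 2. *)
Lemma acyclic_degree_sum (G : sgraph) (S : {set G}) :
  acyclic_graph G -> S != set0 ->
  (\sum_(v in S) #|[set w in S | adj v w]| + 2 <= 2 * #|S|)%N.
Proof.
move=> acyc; have [l] := ubnP #|S|; elim: l S => // l IH S Sl S0.
have [v vS v1] := acyclic_leaf acyc S0.
have -> : (\sum_(z in S) #|[set w in S | adj z w]| =
  #|[set w in S | adj v w]| * 2 + \sum_(z in S :\ v) #|[set w in S :\ v | adj z w]|)%N.
  rewrite (big_setD1 v) //= muln2 -addnn -addnA; congr addn.
  have -> : #|[set w in S | adj v w]| = (\sum_(z in S :\ v) adj v z)%N.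
    rewrite -sum1dep_card big_mkcond [RHS]big_mkcond; apply: eq_bigr => z _.
    rewrite !inE; case: eqP => [->|_] /=; first by rewrite adj_irr andbF.
    by case: (z \in S); case: (adj v z).
  rewrite -big_split /=; apply: eq_bigr => z _.
  rewrite (cardsD1 v) inE vS adj_sym; congr addn; apply: eq_card => w.
  by rewrite !inE andbA.
have := cardsD1 v S; rewrite vS => cS.
case: (eqVneq (S :\ v) set0) => [S'0|S'0]; last by have := IH _ _ S'0; lia.
rewrite S'0 big_set0 cS S'0 cards0.
suff -> : [set w in S | adj v w] = set0 by rewrite cards0.
apply/setP => w; rewrite !inE; apply/negbTE/negP => /andP[wS vw].
have : w \in S :\ v by rewrite !inE wS andbT; apply: contraTneq vw => ->; rewrite adj_irr.
by rewrite S'0 inE.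
Qed.

Lemma connected_closed (G : sgraph) (B : {set G}) :
  connected_graph G -> B != set0 ->
  (forall x y, x \in B -> adj x y -> y \in B) -> B = setT.
Proof.
move=> [_ conn] /set0Pn[x xB] closedB; apply/setP => y; rewrite inE.
have clB : closed (@adj G) B.
  by move=> a b ab; apply/idP/idP => [/closedB|/closedB]; apply; rewrite // adj_sym.
by rewrite -(closed_connect clB (conn x y)).
Qed.

Lemma connected_degree_gt0 (G : sgraph) (v : G) :
  connected_graph G -> (1 < #|G|)%N -> (0 < degree v)%N.
Proof.
move=> conn; rewrite lt0n; apply: contraTneq => /cards0_eq N0.
suff V : [set v] = setT by rewrite -cardsT -V cards1.
apply: connected_closed => // [|x y]; first by apply/set0Pn; exists v; rewrite inE.
by rewrite inE => /eqP-> vy; have := in_set0 y; rewrite -N0 inE vy.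
Qed.

(** Two adjacent vertices of degree 1 would form a component of order 2. *)
Lemma connected_edge_degree (G : sgraph) (v w : G) :
  connected_graph G -> (2 < #|G|)%N -> adj v w -> (2 < degree v + degree w)%N.
Proof.
move=> conn G3 vw; have G2 : (1 < #|G|)%N by lia.
have dv := connected_degree_gt0 v conn G2; have dw := connected_degree_gt0 w conn G2.
rewrite ltnNge; apply/negP => d2.
have nb1 (x y : G) : adj x y -> (degree x <= 1)%N -> forall z, adj x z -> z = y.
  by move=> xy /card_le1_eqP e z xz; apply/esym/e; rewrite inE.
suff V : [set v; w] = setT by move: G3; rewrite -cardsT -V cards2; case: (_ != _).
apply: connected_closed => // [|x y].
  by apply/set0Pn; exists v; rewrite !inE eqxx.
rewrite !inE => /orP[]/eqP-> xy.
  by rewrite (nb1 _ _ vw _ _ xy) ?eqxx ?orbT //; lia.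
by rewrite adj_sym in vw; rewrite (nb1 _ _ vw _ _ xy) ?eqxx ?orbT //; lia.
Qed.

(** * Degrees in the tree left after deleting [u] *)

(* The degree of [v] in the tree [G - u], meaningful for [v != u] only. *)
Definition tdeg (G : sgraph) (u v : G) : nat := #|[set w | (w != u) && adj v w]|.

Lemma degree_tdeg (G : sgraph) (u v : G) : degree v = (tdeg u v + adj v u)%N.
Proof.
rewrite /degree (cardsD1 u) inE addnC; congr addn.
by apply: eq_card => w; rewrite !inE.
Qed.

Lemma degree_delete (G : sgraph) (u : G) (x : delete_vertex u) :
  degree x = tdeg u (val x).
Proof.
rewrite /tdeg /degree -(card_imset _ val_inj); apply: eq_card => w.
rewrite inE; apply/imsetP/andP => [[y + ->]|[wu xw]]; first by rewrite inE (valP y).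
by exists (exist _ w wu); rewrite ?inE.
Qed.

Lemma card_delete (G : sgraph) (u : G) : #|delete_vertex u| = #|G|.-1.
Proof. by rewrite card_sig -(cardC1 u); apply: eq_card. Qed.

Lemma tree_sum_tdeg (G : sgraph) (u : G) : is_tree (delete_vertex u) ->
  (\sum_(v | v != u) tdeg u v + 2 <= 2 * #|G|.-1)%N.
Proof.
case=> [[T0 _] acyc]; rewrite -(card_delete u).
have -> : (\sum_(v | v != u) tdeg u v = \sum_(x : delete_vertex u) degree x)%N.
  transitivity (\sum_(x : delete_vertex u) tdeg u (val x))%N; last first.
    by apply: eq_bigr => x _; rewrite degree_delete.
  rewrite (reindex_omap (val : delete_vertex u -> G) insub); last by move=> v vu; rewrite insubT.
  by apply: eq_bigl => x; rewrite valK eqxx andbT (valP x).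
have := @acyclic_degree_sum _ [set: delete_vertex u] acyc.
rewrite cardsT -card_gt0 cardsT => /(_ T0); congr (_ + _ <= _)%N.
apply: eq_big => x; rewrite ?inE // => _; apply: eq_card => y; by rewrite !inE.
Qed.

Lemma tree_tdeg_gt0 (G : sgraph) (u v : G) : is_tree (delete_vertex u) ->
  (2 < #|G|)%N -> v != u -> (0 < tdeg u v)%N.
Proof.
move=> [conn _] G3 vu.
rewrite -(@degree_delete _ u (exist _ v vu)); apply: connected_degree_gt0 => //.
rewrite card_delete; lia.
Qed.

Lemma tree_edge_tdeg (G : sgraph) (u v w : G) : is_tree (delete_vertex u) ->
  (3 < #|G|)%N -> v != u -> w != u -> adj v w -> (2 < tdeg u v + tdeg u w)%N.
Proof.
move=> [conn _] G3 vu wu vw.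
rewrite -(@degree_delete _ u (exist _ v vu)) -(@degree_delete _ u (exist _ w wu)).
apply: connected_edge_degree => //; rewrite card_delete; lia.
Qed.

(** * Elementary estimates for the weight of an edge *)

Lemma sqrt_le (R : rcfType) (x y : R) : 0 <= y -> x <= y ^+ 2 -> Num.sqrt x <= y.
Proof. by move=> y0 xy; rewrite -[leRHS]ger0_norm // -sqrtr_sqr ler_wsqrtr. Qed.

Lemma le_sqrt (R : rcfType) (x y : R) : x ^+ 2 <= y -> x <= Num.sqrt y.
Proof. by move=> xy; rewrite (le_trans (ler_norm x)) // -sqrtr_sqr ler_wsqrtr. Qed.

Lemma hypot_le (R : rcfType) (a b c d : nat) :
  (a ^ 2 + b ^ 2 <= c ^ 2 + d ^ 2)%N -> hypot R a b <= hypot R c d.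
Proof. by move=> le; rewrite /hypot ler_wsqrtr // -!natrX -!natrD ler_nat. Qed.

Lemma hypot_lt (R : rcfType) (a b c d : nat) :
  (a ^ 2 + b ^ 2 < c ^ 2 + d ^ 2)%N -> hypot R a b < hypot R c d.
Proof.
by move=> lt; rewrite /hypot -!natrX -!natrD ltr_sqrt ?ltr_nat // ltr0n (leq_ltn_trans _ lt).
Qed.

Lemma hypot_gel (R : rcfType) (a b : nat) : a%:R <= hypot R a b.
Proof. by apply: le_sqrt; rewrite lerDl sqr_ge0. Qed.

(** Squaring reduces the claim to [b%:R <= hypot R a b]. *)
Lemma hypot_lip (R : rcfType) (a b x : nat) : hypot R a (b + x) <= hypot R a b + x%:R.
Proof.
have b_le : b%:R <= hypot R a b by apply: le_sqrt; rewrite lerDr sqr_ge0.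
have x0 : 0 <= x%:R :> R by apply: ler0n.
have E : hypot R a b ^+ 2 = a%:R ^+ 2 + b%:R ^+ 2 by rewrite sqr_sqrtr // addr_ge0 ?sqr_ge0.
apply: sqrt_le; first by rewrite addr_ge0 ?sqrtr_ge0.
by rewrite sqrrD E natrD; nra.
Qed.

(** The shift by 1 allows for adjacency to [u]. After squaring, the slack is $2ab - 2(a+b)/3 -
    14/9$; it is negative at $a = b = 1$ and at least $4/9$ otherwise. *)
Lemma hypot_edge (R : rcfType) (a b : nat) : (0 < a)%N -> (0 < b)%N -> (2 < a + b)%N ->
  hypot R (a + 1) (b + 1) <= (a%:R + 3^-1) + (b%:R + 3^-1).
Proof.
rewrite -(ler1n R) => a1; rewrite -(ler1n R) => b1; rewrite -(ler_nat R) natrD => ab3.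
by apply: sqrt_le; rewrite ?natrD; nra.
Qed.

(** * Crude bounds when no tree degree reaches [n - 3] *)

Lemma sombor_split (R : rcfType) (G : sgraph) (u : G) :
  sombor R G *+ 2 = (\sum_(w | adj u w) hypot R (degree u) (degree w)) *+ 2 +
    \sum_(v | v != u) \sum_(w | (w != u) && adj v w) hypot R (degree v) (degree w).
Proof.
rewrite -sombor_double (bigD1 u) //= mulr2n -addrA; congr (_ + _).
have -> : \sum_(w | adj u w) hypot R (degree u) (degree w) =
    \sum_(v | v != u) \sum_(w | (w == u) && adj v w) hypot R (degree v) (degree w).
  rewrite big_mkcond (bigD1 u) //= adj_irr add0r; apply: eq_bigr => v vu.
  rewrite big_mkcondr big_pred1_eq adj_sym; case: ifP => // _.
  by rewrite /hypot addrC.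
rewrite -big_split /=; apply: eq_bigr => v vu.
by rewrite (bigID (pred1 u)); congr (_ + _); apply: eq_bigl => w; rewrite andbC.
Qed.

(** The tree degrees add up to at most $2(n-2)$, and each of the $n-2$ vertices other than [u] and
    [c] uses at least 1. The excess left for these vertices is thus at most [n - 2 - tdeg u c]. *)
Lemma sum_tdeg_pred (G : sgraph) (n : nat) (u c : G) :
  #|G| = n -> is_tree (delete_vertex u) -> (2 < n)%N -> c != u ->
  (\sum_(v | (v != u) && (v != c)) (tdeg u v).-1 + tdeg u c <= n - 2)%N.
Proof.
move=> nG T G3 cu; have G3' : (2 < #|G|)%N by rewrite nG.
have := tree_sum_tdeg T; rewrite nG (bigD1 c) //=.
have -> : (\sum_(v | (v != u) && (v != c)) tdeg u v =
   \sum_(v | (v != u) && (v != c)) (tdeg u v).-1 + \sum_(v | (v != u) && (v != c)) 1)%N.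
  rewrite -big_split /=; apply: eq_bigr => v /andP[vu _].
  by have := tree_tdeg_gt0 T G3' vu; rewrite addn1; case: tdeg.
have : (\sum_(v | v != u) 1 = n.-1)%N by rewrite sum1_card cardC1 nG.
rewrite (bigD1 c) //=; set A := bigop _ _ _; set B := bigop _ _ _; lia.
Qed.

Lemma tree_part_le (R : rcfType) (G : sgraph) (n : nat) (u : G) :
  #|G| = n -> is_tree (delete_vertex u) -> (3 < n)%N ->
  \sum_(v | v != u) \sum_(w | (w != u) && adj v w) hypot R (degree v) (degree w) <=
  ((\sum_(v | v != u) tdeg u v ^ 2)%:R + 2 / 3 * (n - 2)%:R) *+ 2.
Proof.
move=> nG T G4; have G3 : (2 < n)%N by lia.
have [G4' G3'] : (3 < #|G|)%N /\ (2 < #|G|)%N by rewrite nG.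
(* With the 2/3 split evenly, the edge bound is [g v + g w], so its sum over
   directed edges is twice the sum of [tdeg u v * g v]. *)
pose g v : R := (tdeg u v)%:R + 3^-1.
apply: (@le_trans _ _ (\sum_(v | v != u) \sum_(w | (w != u) && adj v w) (g v + g w))).
  apply: ler_sum => v vu; apply: ler_sum => w /andP[wu vw].
  have av := tree_tdeg_gt0 T G3' vu; have aw := tree_tdeg_gt0 T G3' wu.
  apply: le_trans (hypot_edge R av aw (tree_edge_tdeg T G4' vu wu vw)).
  by apply: hypot_le; rewrite !(degree_tdeg u) leq_add // leq_exp2r // leq_add2l leq_b1.
have E : \sum_(v | v != u) \sum_(w | (w != u) && adj v w) g v =
    (\sum_(v | v != u) tdeg u v ^ 2)%:R + 3^-1 * (\sum_(v | v != u) tdeg u v)%:R.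
  rewrite !natr_sum mulr_sumr -big_split /=; apply: eq_bigr => v _.
  rewrite sumr_const -mulr_natl /g (_ : #|_| = tdeg u v); first by rewrite natrX; ring.
  by apply: eq_card => w; rewrite !inE.
have E' : \sum_(v | v != u) \sum_(w | (w != u) && adj v w) g w =
    \sum_(v | v != u) \sum_(w | (w != u) && adj v w) g v.
  rewrite (exchange_big_dep (fun w => w != u)) /=; last by move=> ? ? _ /andP[].
  apply: eq_bigr => w wu; apply: eq_bigl => v.
  by rewrite wu adj_sym.
rewrite (eq_bigr (fun v => \sum_(w | (w != u) && adj v w) g v +
    \sum_(w | (w != u) && adj v w) g w)); last by move=> v _; rewrite big_split.
rewrite big_split /= E' E; have := tree_sum_tdeg T; rewrite nG -(ler_nat R).
have -> : (2 * n.-1)%:R = 2 * (n - 2)%:R + 2 :> R.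
  by rewrite -natrM -natrD; congr _%:R; lia.
rewrite natrD; lra.
Qed.

(** The two irrational terms kept here are those that also appear in [Qprime_bound_ge]; they cancel,
    and a comparison of integers remains. *)
Lemma sombor_upper (R : rcfType) (G : sgraph) (n k : nat) (u c : G) :
  #|G| = n -> is_tree (delete_vertex u) -> (3 < n)%N -> c != u -> (tdeg u c + 1 <= n - 2)%N ->
  degree u = k ->
  sombor R G <= (\sum_(v | v != u) tdeg u v ^ 2)%:R + 2 / 3 * (n - 2)%:R
    + (k%:R - 1) * hypot R k 2 + hypot R k (n - 2) + (n - 2 - tdeg u c)%:R.
Proof.
move=> nG T G4 cu ac dk; have G3 : (2 < n)%N by lia.
have [G4' G3'] : (3 < #|G|)%N /\ (2 < #|G|)%N by rewrite nG.
(* [g] bounds the excess of an edge at [u] over $\sqrt{k^2+4}$. It is nonnegative, so its sum over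
   the neighbours of [u] may be extended to all vertices of the tree. *)
pose g v : R := if v == c then hypot R k (n - 2) - hypot R k 2 else (tdeg u v).-1%:R.
have gc0 : 0 <= hypot R k (n - 2) - hypot R k 2.
  by rewrite subr_ge0; apply: hypot_le; rewrite leq_add2l leq_exp2r //;
    have := tree_tdeg_gt0 T G3' cu; lia.
have Apart : \sum_(w | adj u w) hypot R k (degree w) <=
    k%:R * hypot R k 2 + (hypot R k (n - 2) - hypot R k 2 + (n - 2 - tdeg u c)%:R).
  apply: (@le_trans _ _ (\sum_(w | adj u w) (hypot R k 2 + g w))).
    apply: ler_sum => w uw; have wu : w != u by apply: contraTneq uw => ->; rewrite adj_irr.
    rewrite (degree_tdeg u) adj_sym uw /g; case: eqP => [->|_].
      by rewrite addrCA subrr addr0; apply: hypot_le; rewrite leq_add2l leq_exp2r.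
    have := tree_tdeg_gt0 T G3' wu; case: tdeg => // d _; rewrite addn1 -addn2 addnC.
    exact: hypot_lip.
  rewrite big_split /= sumr_const mulr_natl lerD //.
    rewrite (_ : #|_| = k) // -dk /degree.
    by apply: eq_card => w; rewrite !inE.
  apply: (@le_trans _ _ (\sum_(w | w != u) g w)).
    rewrite [leRHS](bigID (adj u)) /= (eq_bigl (fun w => (w != u) && adj u w)); last first.
      by move=> w; case: eqP => [->|//]; rewrite adj_irr.
    by rewrite lerDl sumr_ge0 // => w _; rewrite /g; case: eqP => // _; apply: ler0n.
  rewrite (bigD1 c) //= {1}/g eqxx lerD2l.
  rewrite (eq_bigr (fun v => (tdeg u v).-1%:R)); last first.
    by move=> v /andP[_ /negbTE]; rewrite /g => ->.
  by rewrite -natr_sum ler_nat; have := sum_tdeg_pred nG T G3 cu; set A := bigop _ _ _; lia.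
have := tree_part_le R nG T G4; have := sombor_split R u; rewrite dk; lra.
Qed.

(** By convexity, the squares outside [c] are largest when a single vertex takes the whole excess
    [n - 2 - tdeg u c]. *)
Lemma sum_tdeg_sqr_le (G : sgraph) (n : nat) (u c : G) :
  #|G| = n -> is_tree (delete_vertex u) -> (2 < n)%N -> c != u ->
  (\sum_(v | v != u) tdeg u v ^ 2 <=
   tdeg u c ^ 2 + (n - 2 - tdeg u c) * (n - tdeg u c) + (n - 2))%N.
Proof.
move=> nG T G3 cu; have G3' : (2 < #|G|)%N by rewrite nG.
have S := sum_tdeg_pred nG T G3 cu; set B := (n - 2 - tdeg u c)%N.
rewrite (bigD1 c) //= -addnA leq_add2l.
(* For $d \le B$, $(d+1)^2 = d(d+2)+1 \le d(B+2)+1$, which is linear in the excess $d$. *)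
apply: (@leq_trans (\sum_(v | (v != u) && (v != c)) ((tdeg u v).-1 * (B + 2) + 1))).
  apply: leq_sum => v vuc; have : ((tdeg u v).-1 <= B)%N.
    have := S; rewrite (bigD1 v) //= /B; set A := bigop _ _ _; lia.
  case/andP: vuc => vu _; have := tree_tdeg_gt0 T G3' vu; case: tdeg => // d _ /=; nia.
rewrite big_split /= -big_distrl /= leq_add //.
  have -> : (n - tdeg u c = B + 2)%N by rewrite /B; lia.
  by rewrite leq_mul2r; apply/orP; right; rewrite /B leq_subRL; lia.
have : (\sum_(v | v != u) 1 = n.-1)%N by rewrite sum1_card cardC1 nG.
rewrite (bigD1 c) //=; set A := bigop _ _ _; lia.
Qed.

Definition Qprime_bound (R : rcfType) (n k : nat) : R :=
  (k%:R - 2) * hypot R k 2 + (k%:R - 3) * hypot R (n - 2) 2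
  + (n%:R - k%:R - 1) * hypot R (n - 2) 1 + hypot R k (n - 2)
  + hypot R (n - 2) 3 + hypot R k 3 + hypot R 3 2.

(** In the extremal graph, [n - 3] edges join the center to vertices other than [u], each of weight
    at least [n - 2]; the summand 3 comes from $\sqrt{13} \ge 3$. *)
Lemma Qprime_bound_ge (R : rcfType) (n k : nat) :
  (3 <= k)%N -> (k < n)%N ->
  (k%:R - 1) * hypot R k 2 + hypot R k (n - 2) + ((n - 3) * (n - 2) + 3)%:R <= Qprime_bound R n k.
Proof.
move=> k3 kn; rewrite /Qprime_bound natrD natrM.
have -> : (n - 3)%:R = (k%:R - 3) + (n%:R - k%:R - 1) + 1 :> R.
  by rewrite natrB; [ring | lia].
have k3' : 0 <= k%:R - 3 :> R by rewrite subr_ge0 ler_nat.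
have kn' : 0 <= n%:R - k%:R - 1 :> R by move: kn; rewrite -(ler_nat R) -natr1; lra.
have := hypot_gel R (n - 2) 1; have := hypot_gel R (n - 2) 2; have := hypot_gel R (n - 2) 3.
have := hypot_gel R 3 2.
have : hypot R k 2 <= hypot R k 3 by apply: hypot_le; rewrite leq_add2l.
move: (hypot R k 2) (hypot R k 3) (hypot R k (n - 2)) (hypot R 3 2).
move: (hypot R (n - 2) 1) (hypot R (n - 2) 2) (hypot R (n - 2) 3).
move=> h1 h2 h3 a b c d ab d3 H3 H2 H1; have := ler_wpM2l k3' H2; have := ler_wpM2l kn' H1; lra.
Qed.

(** For the largest [s] the left side is convex in [p]. At the ends $p = 3$ and $p = n-4$ it falls
    short of the right side by $n-20$ and $4n-41$. The factor 3 clears the 2/3 of [sombor_upper]. *)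
Lemma spread_sqr_sum_lt (n p s : nat) : (23 <= n)%N -> (2 < p)%N -> (p < n - 3)%N ->
  (s <= p ^ 2 + (n - 2 - p) * (n - p) + (n - 2))%N ->
  (3 * s + 2 * (n - 2) + 3 * (n - 2 - p) < 3 * ((n - 3) * (n - 2) + 3))%N.
Proof.
move=> n23 p3 pn.
have [i [j [ip jn]]] : exists i j, p = (i + 3)%N /\ n = (i + j + 7)%N.
  by exists (p - 3)%N, (n - p - 4)%N; lia.
subst p n.
have -> : (i + j + 7 - 2 = i + j + 5)%N by lia.
have -> : (i + j + 5 - (i + 3) = j + 2)%N by lia.
have -> : (i + j + 7 - (i + 3) = j + 4)%N by lia.
have -> : (i + j + 7 - 3 = i + j + 4)%N by lia.
have : (16 <= i + j)%N by clear -n23; lia.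
clear; rewrite -mulnn; nia.
Qed.

Lemma sombor_lt_low_tdeg (R : rcfType) (G : sgraph) (n k : nat) (u : G) :
  (23 <= n)%N -> (3 <= k)%N -> (k < n)%N ->
  #|G| = n -> is_tree (delete_vertex u) -> degree u = k ->
  (forall v, v != u -> tdeg u v < n - 3)%N -> sombor R G < Qprime_bound R n k.
Proof.
move=> n23 k3 kn nG T dk low.
have n2 : (3 < n)%N by lia.
have lt c : c != u -> (3 * \sum_(v | v != u) tdeg u v ^ 2 + 2 * (n - 2) + 3 * (n - 2 - tdeg u c)
    < 3 * ((n - 3) * (n - 2) + 3))%N -> sombor R G < Qprime_bound R n k.
  move=> cu; rewrite -(ltr_nat R) !natrD !natrM => lt.
  have : (tdeg u c + 1 <= n - 2)%N by have := low c cu; lia.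
  move/(sombor_upper R nG T n2 cu)/(_ dk); have := Qprime_bound_ge R k3 kn.
  rewrite natrD natrM; lra.
case: (boolP [exists c, (c != u) && (2 < tdeg u c)%N]) => [/existsP[c /andP[cu ac]]|].
  apply: (lt c cu); exact: spread_sqr_sum_lt n23 ac (low c cu) (sum_tdeg_sqr_le nG T (ltnW n2) cu).
rewrite negb_exists => /forallP lo.
have lo2 v : v != u -> (tdeg u v <= 2)%N by move=> vu; have := lo v; rewrite vu /= -leqNgt.
have [c cu] : exists c, c != u.
  by apply/existsP; rewrite -negb_forall; apply/negP => /forallP A; have := nG;
     rewrite (@eq_card1 _ u) => [|x]; [lia | rewrite !inE A].
apply: (lt c cu).
have : (\sum_(v | v != u) tdeg u v ^ 2 <= 2 * \sum_(v | v != u) tdeg u v)%N.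
  by rewrite big_distrr /=; apply: leq_sum => v /lo2 v2; rewrite -mulnn leq_mul2r v2 orbT.
have := tree_sum_tdeg T; rewrite nG.
set A := bigop _ _ _; set B := bigop _ _ _.
(* All tree degrees are at most 2 here, so the left side is at most $17(n-2)$, well below $3 \cdot
   19(n-2)$. *)
have : (19 * (n - 2) <= (n - 3) * (n - 2))%N by rewrite leq_mul2r; lia.
move: ((n - 3) * (n - 2))%N => P; lia.
Qed.

(** * Trees with a vertex of degree [n - 2] or [n - 3] *)

Lemma iso_of_inj (G H : sgraph) (h : H -> G) : injective h -> (#|G| <= #|H|)%N ->
  (forall x y, adj (h x) (h y) = adj x y) -> isomorphic G H.
Proof.
move=> h_inj cardGH adj_h; have [f hK fK] := inj_card_bij h_inj cardGH.
exists f; first by exists h.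
by move=> x y; rewrite -adj_h !fK.
Qed.

(** Listing the neighbours of [u] before the other leaves turns adjacency to [u] into a bound on the
    index, the form used in [Qgraph] and [Qstar]. *)
Lemma nth_enum_cat (T : finType) (A B : {set T}) (p : pred T) (d : T) (i : nat) :
  {in A, forall v, p v} -> {in B, forall v, ~~ p v} -> (i < #|A| + #|B|)%N ->
  p (nth d (enum A ++ enum B) i) = (i < #|A|)%N.
Proof.
move=> pA pB lt; rewrite nth_cat -cardE; case: ltnP => iA.
  by apply: pA; rewrite -mem_enum mem_nth // -cardE.
by apply/negbTE/pB; rewrite -mem_enum mem_nth // -cardE; lia.
Qed.

Definition star_at (G : sgraph) (u c : G) : Prop :=
  c != u /\ forall v w, v != u -> w != u -> adj v w = ((v == c) != (w == c)).

(* [G - u] is a star with center [c], one of whose leaves, [x], carries an extra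
   pendant vertex [y]. *)
Definition broom_at (G : sgraph) (u c x y : G) : Prop :=
  [/\ uniq [:: u; c; x; y],
      forall v w, v != u -> v != y -> w != u -> w != y -> adj v w = ((v == c) != (w == c)) &
      forall v, v != u -> adj y v = (v == x)].

(** [sum_tdeg_pred] leaves no excess outside [c], so every other tree vertex has [c] as its only
    tree neighbour. *)
Lemma hub_star (G : sgraph) (n : nat) (u c : G) :
  #|G| = n -> is_tree (delete_vertex u) -> (2 < n)%N -> c != u ->
  (n - 2 <= tdeg u c)%N -> star_at u c.
Proof.
move=> nG T n3 cu ac; have S := sum_tdeg_pred nG T n3 cu.
have G3 : (2 < #|G|)%N by rewrite nG.
have uc : u != c by rewrite eq_sym.
have cv v : v != u -> v != c -> adj c v.
  move=> vu vc; have : [set w | (w != u) && adj c w] == ~: [set u; c].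
    rewrite eqEcard cardsCs setCK cards2 uc nG ac andbT; apply/subsetP => w.
    by rewrite !inE negb_or => /andP[-> cw]; apply: contraTneq cw => ->; rewrite adj_irr.
  by move/eqP/setP/(_ v); rewrite !inE negb_or vu vc.
have vw v w : v != u -> v != c -> w != u -> adj v w -> w = c.
  move=> vu vc wu vw; have : (tdeg u v <= 1)%N.
    move: S; rewrite (bigD1 v) ?vu //=; have := tree_tdeg_gt0 T G3 vu.
    by set A := bigop _ _ _; lia.
  move/card_le1_eqP; apply; rewrite inE ?wu //.
  by rewrite cu adj_sym cv.
split=> // v w vu wu; case: (eqVneq v c) => [->|vc]; case: (eqVneq w c) => [->|wc] /=.
- exact: adj_irr.
- exact: cv.
- by rewrite adj_sym cv.
- by apply/negbTE; apply: contraNN wc => /(vw v w vu vc wu)/eqP.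
Qed.

(** Exactly one other tree vertex [y] is missed by [c]. A tree neighbour [x] of [y] is adjacent to
    [c] as well, so it absorbs the single unit of excess left by [sum_tdeg_pred], and the remaining
    vertices have tree degree 1. *)
Lemma hub_broom (G : sgraph) (n : nat) (u c : G) :
  #|G| = n -> is_tree (delete_vertex u) -> (2 < n)%N -> c != u ->
  tdeg u c = (n - 3)%N -> exists x y, broom_at u c x y.
Proof.
move=> nG T n3 cu ac; have S := sum_tdeg_pred nG T n3 cu.
have G3 : (2 < #|G|)%N by rewrite nG.
have uc : u != c by rewrite eq_sym.
set N := [set w | (w != u) && adj c w].
have sub : N \subset ~: [set u; c].
  apply/subsetP => w; rewrite !inE negb_or => /andP[-> cw].
  by apply: contraTneq cw => ->; rewrite adj_irr.
have /cards1P[y Dy] : #|~: [set u; c] :\: N| == 1%N.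
  rewrite cardsD (setIidPr sub) cardsCs setCK cards2 uc nG -/(tdeg u c) ac; lia.
have cE v : v != u -> v != c -> adj c v = (v != y).
  move=> vu vc; have := congr1 (fun D : {set G} => v \in D) Dy.
  by rewrite !inE negb_or vu vc /= => <-; rewrite andbT negbK.
have : y \in ~: [set u; c] :\: N by rewrite Dy inE.
rewrite !inE negb_or => /and3P[_ yu yc].
have cy : adj c y = false by rewrite cE // eqxx.
have : (0 < tdeg u y)%N by apply: tree_tdeg_gt0.
case/card_gt0P => x; rewrite inE => /andP[xu yx].
have xc : x != c by apply: contraTneq yx => ->; rewrite adj_sym cy.
have xy : x != y by apply: contraTneq yx => ->; rewrite adj_irr.
have cx : adj c x by rewrite cE.
have x2 : (2 <= tdeg u x)%N.
  rewrite (_ : 2%N = #|[set c; y]|); last by rewrite cards2 eq_sym yc.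
  apply/subset_leq_card/subsetP => z.
  by rewrite !inE => /orP[]/eqP->; rewrite ?cu ?yu adj_sym ?cx ?yx.
have low v : v != u -> v != c -> v != x -> tdeg u x = 2%N /\ (tdeg u v <= 1)%N.
  move=> vu vc vx; move: S; rewrite ac (bigD1 x) ?xu //= (bigD1 v) ?vu ?vc //=.
  move: (bigop _ _ _) (tree_tdeg_gt0 T G3 vu) x2 n3 => A; clear.
  move: (tdeg u x) (tdeg u v) => a b; lia.
have yx' : y != x by rewrite eq_sym.
have yE v : v != u -> adj y v -> v = x.
  move=> vu yv; have [_] := low y yu yc yx'.
  by move/card_le1_eqP; apply; rewrite inE ?vu ?xu.
have xE v : v != u -> adj x v -> (v == c) || (v == y).
  move=> vu xv; have [x2' _] := low y yu yc yx'.
  have /eqP/setP/(_ v) : [set c; y] == [set w | (w != u) && adj x w].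
    rewrite eqEcard -/(tdeg u x) x2' cards2 eq_sym yc andbT; apply/subsetP => z.
    by rewrite !inE => /orP[]/eqP->; rewrite ?cu ?yu adj_sym ?cx ?yx.
  by rewrite !inE vu xv.
exists x, y; split.
- by rewrite /= !inE !negb_or !(eq_sym u) cu xu yu !(eq_sym c) xc yc xy.
- move=> v w vu vy wu wy.
  case: (eqVneq v c) => [->|vc]; case: (eqVneq w c) => [->|wc] /=.
  + exact: adj_irr.
  + by rewrite cE.
  + by rewrite adj_sym cE.
  apply/negbTE/negP => vw; case: (eqVneq v x) => [vx|vx].
    by have := xE w wu; rewrite -vx => /(_ vw); rewrite (negbTE wc) (negbTE wy).
  have [_] := low v vu vc vx; move/card_le1_eqP/(_ w c).
  by rewrite !inE wu cu vw adj_sym cE // vy => /(_ isT isT) E; rewrite E eqxx in wc.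
- move=> v vu; apply/idP/eqP => [|->]; [exact: yE | exact: yx].
Qed.

(** The leaves are interchangeable, so only the number of those adjacent to [u] and the adjacency of
    [u] to [c] matter; the latter decides between the two graphs. *)
Lemma star_iso (G : sgraph) (n : nat) (u c : G) : #|G| = n -> star_at u c ->
  isomorphic G (Qgraph n (degree u)) \/ isomorphic G (Qstar n (degree u)).
Proof.
move=> nG [cu adjE]; have uc : u != c by rewrite eq_sym.
pose P := [set v | [&& v != u, v != c & adj u v]].
pose P' := [set v | [&& v != u, v != c & ~~ adj u v]].
have PP' : (#|P| + #|P'| + 2 = n)%N.
  have PE : P = ~: [set u; c] :&: [set v | adj u v].
    by apply/setP => v; rewrite !inE negb_or andbA.
  have P'E : P' = ~: [set u; c] :\: [set v | adj u v].
    by apply/setP => v; rewrite !inE negb_or; case: adj; rewrite ?andbT ?andbF.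
  have := cardsC [set u; c]; rewrite cards2 uc nG => <-.
  by rewrite PE P'E cardsID addnC.
(* The vertex at position [i] plays the role of vertex [i] of the star. *)
pose s := c :: enum P ++ enum P'.
have sz : size s = (n - 1)%N by rewrite /= size_cat -!cardE; lia.
have us : u \notin s.
  by rewrite inE negb_or uc mem_cat !mem_enum !inE eqxx.
have s_uniq : uniq s.
  rewrite /= mem_cat !mem_enum !inE eqxx !andbF /= cat_uniq !enum_uniq andbT /=.
  by apply/hasPn => v; rewrite !mem_enum !inE => /and3P[-> -> /negbTE->].
have nthu i : (i < n - 1)%N -> nth u s i != u.
  by move=> lt; apply: contraNneq us => <-; rewrite mem_nth ?sz.
have nthc i : (i < n - 1)%N -> (nth u s i == c) = (i == 0%N).
  by move=> lt; rewrite -[c]/(nth u s 0) nth_uniq ?sz //; lia.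
have nthP i : (0 < i)%N -> (i < n - 1)%N -> adj u (nth u s i) = (i <= #|P|)%N.
  case: i => // i _ lt; apply: nth_enum_cat => [v|v|]; rewrite ?inE; last by lia.
    by case/and3P.
  by case/and3P.
have dP : degree u = (adj u c + #|P|)%N.
  rewrite /degree (cardsD1 c) inE; congr (_ + _)%N; apply: eq_card => v; rewrite !inE.
  by case: (eqVneq v u) => [->|]; rewrite ?adj_irr ?andbF.
pose h (H : {set 'I_(n - 1)}) (z : @add_vertex (star (n - 1)) H) : G :=
  if z is Some i then nth u s (i : 'I_(n - 1)) else u.
have iso (H : {set 'I_(n - 1)}) : (forall i : 'I_(n - 1), (i \in H) = adj u (nth u s i)) ->
    isomorphic G (@add_vertex (star (n - 1)) H).
  move=> HE; apply: (@iso_of_inj _ _ (h H)).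
  - move=> [i|] [j|] //= => [E|E|E].
    + by congr Some; apply: val_inj; move/eqP: E; rewrite nth_uniq ?sz // => /eqP.
    + by have := nthu i (ltn_ord i); rewrite E eqxx.
    + by have := nthu j (ltn_ord j); rewrite -E eqxx.
  - by rewrite card_option card_ord nG; lia.
  - move=> [i|] [j|] /=; rewrite ?HE ?adj_irr //; last by rewrite adj_sym.
    by rewrite adjE ?nthu // !nthc.
(* If [u] is adjacent to [c], its degree is [#|P| + 1], so the strict bound in [Qgraph] selects
   position 0 and [#|P|] leaves. *)
case uc' : (adj u c); [left | right]; apply: iso => i; rewrite inE dP uc'.
  case: (posnP i) => [->|i0]; first by rewrite /= uc'.
  by rewrite nthP // add1n.
case: (posnP i) => [->|i0]; first by rewrite /= uc'.
by rewrite nthP.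
Qed.

(** * The exact Sombor index over a broom *)

(* The Sombor index of [G] when [broom_at u c x y]: [ec], [ex], [ey] tell whether
   [c], [x], [y] are adjacent to [u], and [j] counts the other neighbours of [u]. *)
Definition broom_value (R : rcfType) (n k j : nat) (ec ex ey : bool) : R :=
  j%:R * (hypot R k 2 + hypot R (n - 3 + ec) 2) + (n - 4 - j)%:R * hypot R (n - 3 + ec) 1
  + ec%:R * hypot R k (n - 3 + ec) + ex%:R * hypot R k 3 + ey%:R * hypot R k 2
  + hypot R (n - 3 + ec) (2 + ex) + hypot R (1 + ey) (2 + ex).

Section Broom.
Variables (G : sgraph) (u c x y : G).
Hypothesis br : broom_at u c x y.
Local Notation s := [:: u; c; x; y].

Let neqs : [/\ c != u, x != u, y != u & [/\ x != c, y != c & x != y]].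
Proof.
case: br => + _ _; rewrite /= !inE !negb_or !(eq_sym u) !(eq_sym c).
by move=> /and4P[/and3P[-> -> ->] /andP[-> ->] -> _].
Qed.

Let adj_y v : v != u -> adj v y = (v == x).
Proof. by case: br => _ _ yE; rewrite adj_sym => /yE. Qed.

Let adj_T v w : v != u -> v != y -> w != u ->
  adj v w = if w == y then v == x else (v == c) != (w == c).
Proof.
move=> vu vy wu; case: eqVneq => [->|wy]; first exact: adj_y.
by case: br => _ + _; apply.
Qed.

Lemma broom_tdeg_center : tdeg u c = (#|G| - 3)%N.
Proof.
have [cu xu yu [xc yc xy]] := neqs.
rewrite -(cardsC [set u; c; y]) (_ : #|[set u; c; y]| = 3); last first.
  by rewrite setUC cardsU1 !inE (negbTE yu) (negbTE yc) cards2 eq_sym cu.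
rewrite addKn; apply: eq_card => w; rewrite !inE !negb_or -andbA.
case: (eqVneq w u) => //= wu; rewrite adj_T ?(eq_sym c y) // eqxx (eq_sym c x) (negbTE xc).
by case: (w == y); rewrite ?andbT ?andbF //; case: (w == c).
Qed.

Lemma broom_tdeg_x : tdeg u x = 2%N.
Proof.
have [cu xu yu [xc yc xy]] := neqs.
rewrite (_ : 2%N = #|[set c; y]|); last by rewrite cards2 eq_sym yc.
apply: eq_card => w; rewrite !inE; case: (eqVneq w u) => [->|wu] /=.
  by rewrite ![u == _]eq_sym (negbTE cu) (negbTE yu).
rewrite adj_T // eqxx (negbTE xc); case: (w == y); rewrite ?orbT ?orbF //.
by case: (w == c).
Qed.

Lemma broom_tdeg_y : tdeg u y = 1%N.
Proof.
have [cu xu yu [xc yc xy]] := neqs.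
rewrite -(cards1 x); apply: eq_card => w; rewrite !inE.
by case: (eqVneq w u) => [->|wu] /=; rewrite ?(eq_sym u) ?(negbTE xu) // adj_sym adj_y.
Qed.

Lemma broom_tdeg_leaf v : v \notin [:: u; c; x; y] -> tdeg u v = 1%N.
Proof.
have [cu xu yu [xc yc xy]] := neqs.
rewrite !inE !negb_or => /and4P[vu vc vx vy].
rewrite -(cards1 c); apply: eq_card => w; rewrite !inE.
case: (eqVneq w u) => [->|wu] /=; first by rewrite eq_sym (negbTE cu).
rewrite adj_T // (negbTE vc) (negbTE vx); case: eqP => [->|_]; first by rewrite (negbTE yc).
by case: (w == c).
Qed.

(** Edges at [u] point away from [u], the other edges at [c] away from [c], and the last edge from
    [y] to [x]. Hence only [u], [c] and [y] can have outgoing edges. *)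
Let o v w := [|| (v == u) && adj u w, (v == c) && (w \notin [:: u; c; y]) | (v == y) && (w == x)].

Let oE v w : adj v w = o v w || o w v.
Proof.
have [cu xu yu [xc yc xy]] := neqs; rewrite /o !inE !negb_or.
case: (eqVneq v u) => [->|vu].
  rewrite ![u == _]eq_sym (negbTE cu) (negbTE yu) (negbTE xu) adj_irr !andbF /= !orbF.
  by [].
case: (eqVneq w u) => [->|wu]; rewrite /= ?andbF ?orbF.
  by rewrite !(eq_sym u) (negbTE xu) (negbTE cu) (negbTE yu) andbF /= !orbF adj_sym.
case: (eqVneq v y) => [->|vy].
  by rewrite adj_sym adj_y // (eq_sym y x) (negbTE xy) !andbF !orbF (negbTE yc).
rewrite adj_T //; case: (eqVneq w y) => [->|wy].
  by rewrite (negbTE yc) /= !andbF.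
by case: (v == c); case: (w == c).
Qed.

Let o_anti v w : o v w -> ~~ o w v.
Proof.
have [cu xu yu [xc yc xy]] := neqs; rewrite /o !inE !negb_or.
case/or3P => [/andP[/eqP-> uw]|/andP[/eqP-> /and3P[wu wc wy]]|/andP[/eqP-> /eqP->]].
- have wu : w != u by apply: contraTneq uw => ->; rewrite adj_irr.
  by rewrite eqxx (eq_sym u x) (negbTE xu) (negbTE wu) /= !andbF.
- by rewrite (negbTE wu) (negbTE wy) /= eqxx !andbF.
- by rewrite (negbTE xu) (negbTE xc) (negbTE xy).
Qed.

(** An arbitrary commutative law covers both the count of neighbours and the real sums. *)
Let sumE (R : Type) (idx : R) (op : Monoid.com_law idx) (F : G -> R) :
  \big[op/idx]_v F v = op (op (F u) (op (F c) (op (F x) (F y))))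
                           (\big[op/idx]_(v | v \notin [:: u; c; x; y]) F v).
Proof.
have us : uniq [:: u; c; x; y] by case: br.
by rewrite (bigID (mem [:: u; c; x; y])) /= -big_uniq //= !big_cons big_nil Monoid.mulm1.
Qed.

Lemma card_broom_leaves : #|[set v | v \notin s]| = (#|G| - 4)%N.
Proof.
have us : uniq s by case: br.
have := cardC (mem s); rewrite (card_uniqP us) /= => <-.
by rewrite addKn; apply: eq_card => v; rewrite inE.
Qed.

Lemma broom_degree :
  degree u = (#|[set v | (v \notin s) && adj u v]| + adj u c + adj u x + adj u y)%N.
Proof.
rewrite /degree -sum1dep_card big_mkcond sumE /= adj_irr -big_mkcondr sum1dep_card.
by do 3!case: adj; lia.
Qed.

Lemma broom_sombor (R : rcfType) (n k : nat) : #|G| = n -> degree u = k ->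
  exists2 j : nat, (j + adj u c + adj u x + adj u y = k)%N /\ (j <= n - 4)%N &
    sombor R G = broom_value R n k j (adj u c) (adj u x) (adj u y).
Proof.
move=> nG dk; have [cu xu yu [xc yc xy]] := neqs.
have cardL : #|[set v | v \notin s]| = (n - 4)%N by rewrite card_broom_leaves nG.
set P := [set v | (v \notin s) && adj u v]; exists #|P|.
  split; first by rewrite -dk broom_degree.
  by rewrite -cardL subset_leq_card //; apply/subsetP => v; rewrite !inE => /andP[].
have cardL' : #|[set v | (v \notin s) && ~~ adj u v]| = (n - 4 - #|P|)%N.
  rewrite -cardL -(cardsID [set v | adj u v] [set v | v \notin s]).
  rewrite (_ : #|_ :&: _| = #|P|); last by apply: eq_card => v; rewrite !inE.
  by rewrite addKn; apply: eq_card => v; rewrite !inE andbC.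
have dc : degree c = (n - 3 + adj u c)%N by rewrite (degree_tdeg u) broom_tdeg_center nG adj_sym.
have dx : degree x = (2 + adj u x)%N by rewrite (degree_tdeg u) broom_tdeg_x adj_sym.
have dy : degree y = (1 + adj u y)%N by rewrite (degree_tdeg u) broom_tdeg_y adj_sym.
have dl v : v \notin s -> degree v = (1 + adj u v)%N.
  by move=> vs; rewrite (degree_tdeg u) broom_tdeg_leaf // adj_sym.
rewrite (sombor_orientation R oE o_anti) sumE /=.
have -> : \sum_(w | o u w) hypot R (degree u) (degree w) =
    (adj u c)%:R * hypot R k (n - 3 + adj u c) + (adj u x)%:R * hypot R k 3 +
    (adj u y)%:R * hypot R k 2 + #|P|%:R * hypot R k 2.
  rewrite (eq_bigl (adj u)); last first.
    by move=> w; rewrite /o eqxx !(eq_sym u) (negbTE cu) (negbTE yu) /= orbF.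
  rewrite big_mkcond sumE /= adj_irr -big_mkcondr dc dx dy dk.
  rewrite (eq_bigr (fun=> hypot R k 2)) => [|v /andP[vs uv]]; last by rewrite dl // uv.
  rewrite sumr_const (_ : #|_| = #|P|); last by apply: eq_card => v; rewrite inE.
  rewrite -mulr_natl; do 3!case: adj; rewrite /=; ring.
have -> : \sum_(w | o c w) hypot R (degree c) (degree w) =
    hypot R (n - 3 + adj u c) (2 + adj u x) + #|P|%:R * hypot R (n - 3 + adj u c) 2 +
    (n - 4 - #|P|)%:R * hypot R (n - 3 + adj u c) 1.
  rewrite (eq_bigl (fun w => w \notin [:: u; c; y])); last first.
    by move=> w; rewrite /o eqxx (negbTE cu) (eq_sym c y) (negbTE yc) /= orbF.
  rewrite big_mkcond sumE /= !inE !eqxx (negbTE xu) (negbTE xc) (negbTE xy) !orbT /= dc dx.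
  rewrite add0r add0r addr0 -addrA; congr (_ + _).
  rewrite (bigID (adj u)) /=; congr (_ + _).
    rewrite (eq_bigr (fun=> hypot R (n - 3 + adj u c) 2)) => [|v /andP[vs uv]].
      rewrite sumr_const mulr_natl; congr (_ *+ _); apply: eq_card => v; by rewrite inE.
    rewrite dl // uv; move: vs; rewrite !inE !negb_or => /and4P[-> -> _ ->] //.
  rewrite (eq_bigr (fun=> hypot R (n - 3 + adj u c) 1)) => [|v /andP[vs /negbTE uv]].
    rewrite -cardL' sumr_const mulr_natl; congr (_ *+ _); apply: eq_card => v; by rewrite inE.
  by rewrite dl // uv; move: vs; rewrite !inE !negb_or => /and4P[-> -> _ ->].
have -> : \sum_(w | o x w) hypot R (degree x) (degree w) = 0.
  by apply: big_pred0 => w; rewrite /o (negbTE xu) (negbTE xc) (negbTE xy).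
have -> : \sum_(w | o y w) hypot R (degree y) (degree w) = hypot R (1 + adj u y) (2 + adj u x).
  rewrite (eq_bigl (pred1 x)) ?big_pred1_eq ?dx ?dy // => w.
  by rewrite /o (negbTE yu) (negbTE yc) eqxx.
rewrite big1 ?addr0 => [|v]; last first.
  rewrite !inE !negb_or => /and4P[vu vc _ vy]; apply: big_pred0 => w.
  by rewrite /o (negbTE vu) (negbTE vc) (negbTE vy).
rewrite /broom_value; ring.
Qed.
End Broom.

(** * Exchanges between brooms *)

Lemma hypotC (R : rcfType) (a b : nat) : hypot R a b = hypot R b a.
Proof. by rewrite /hypot addrC. Qed.

(** With $h = \sqrt{a^2+1} \ge 20$, $(h + 1/10)^2$ exceeds $h^2 + 3$. This bounds the loss on the
    edge to [c] when an ordinary leaf is detached from [u]; 20 is [n - 3] for the least [n]. *)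
Lemma hypot_gap_far (R : rcfType) (a : nat) : (20 <= a)%N -> hypot R a 2 <= hypot R a 1 + 10^-1.
Proof.
rewrite -(ler_nat R) => a20; have := hypot_gel R a 1.
have E : hypot R a 1 ^+ 2 = a%:R ^+ 2 + 1 by rewrite sqr_sqrtr ?expr1n // addr_ge0 ?sqr_ge0.
by move=> h_ge; apply: sqrt_le; [lra | rewrite [leRHS]sqrrD E; lra].
Qed.

(** In each of the six cases, rationals at least 1/5 apart separate the two roots. The gain of 1/5
    on the edge between [x] and [y] outweighs the loss of 1/10 in [hypot_gap_far]. *)
Lemma hypot_gap_near (R : rcfType) (a b : nat) : (0 < a <= 2)%N -> (0 < b <= 3)%N ->
  hypot R a b + 5^-1 <= hypot R a.+1 b.
Proof.
have le (q r : R) (c d c' d' : nat) : c'%:R ^+ 2 + d'%:R ^+ 2 <= q ^+ 2 -> 0 <= q ->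
    r ^+ 2 <= c%:R ^+ 2 + d%:R ^+ 2 -> q + 5^-1 <= r -> hypot R c' d' + 5^-1 <= hypot R c d.
  move=> lo q0 hi qr; have lo' : hypot R c' d' <= q := sqrt_le q0 lo.
  by have hi' : r <= hypot R c d := le_sqrt hi; lra.
case: a => [|[|[|a]]] // _; case: b => [|[|[|[|b]]]] // _.
- by apply: (le (3 / 2) (11 / 5)); lra.
- by apply: (le (9 / 4) (14 / 5)); lra.
- by apply: (le (16 / 5) (18 / 5)); lra.
- by apply: (le (9 / 4) (31 / 10)); lra.
- by apply: (le (17 / 6) (18 / 5)); lra.
- by apply: (le (37 / 10) (42 / 10)); lra.
Qed.

(** The edge of [u] gains strictly, being moved to a vertex of degree [n - 2]. The detached leaf
    costs nothing, since $H^2 + 4 \le (H+1)^2 + 1$ for $H = n - 3$. *)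
Lemma broom_value_center (R : rcfType) (n k j : nat) (ex ey : bool) :
  (2 < k)%N -> (5 < n)%N -> (j.+1 <= n - 4)%N ->
  broom_value R n k j.+1 false ex ey < broom_value R n k j true ex ey.
Proof.
move=> k3 n5 jn; rewrite /broom_value !addn0 addn1 mul0r mul1r addr0 -natr1.
have -> : (n - 4 - j)%:R = (n - 4 - j.+1)%:R + 1 :> R by rewrite natr1; congr _%:R; lia.
set H := (n - 3)%N; set h := (n - 4 - j.+1)%N.
have j0 : 0 <= j%:R :> R by apply: ler0n.
have h0 : 0 <= h%:R :> R by apply: ler0n.
have H2 : hypot R H 2 <= hypot R H.+1 2 by apply: hypot_le; rewrite leq_add2r leq_exp2r.
have H1 : hypot R H 1 <= hypot R H.+1 1 by apply: hypot_le; rewrite leq_add2r leq_exp2r.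
have H21 : hypot R H 2 <= hypot R H.+1 1 by apply: hypot_le; rewrite -!mulnn /H; nia.
have kH : hypot R k 2 < hypot R k H.+1 by apply: hypot_lt; rewrite ltn_add2l ltn_exp2r // /H; lia.
have Hx : hypot R H (2 + ex) <= hypot R H.+1 (2 + ex).
  by apply: hypot_le; rewrite leq_add2r leq_exp2r.
have := ler_wpM2l j0 H2; have := ler_wpM2l h0 H1; lra.
Qed.

(** The edge between [x] and [y] gains at least 1/5, the detached leaf loses at most 1/10 on its
    edge to [c], and the edges from [x] to [u] and [c] only help. *)
Lemma broom_value_x (R : rcfType) (n k j : nat) (ec ey : bool) :
  (23 <= n)%N -> (j.+1 <= n - 4)%N ->
  broom_value R n k j.+1 ec false ey < broom_value R n k j ec true ey.
Proof.
move=> n23 jn; rewrite /broom_value mul0r mul1r -natr1.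
have -> : (n - 4 - j)%:R = (n - 4 - j.+1)%:R + 1 :> R by rewrite natr1; congr _%:R; lia.
have H20 : (20 <= n - 3 + ec)%N by lia.
have := hypot_gap_far R H20; move: (n - 3 + ec)%N {H20} => H.
have : hypot R H (2 + false) <= hypot R H (2 + true).
  by apply: hypot_le; rewrite leq_add2l leq_exp2r.
have : hypot R k 2 <= hypot R k 3 by apply: hypot_le; rewrite leq_add2l leq_exp2r.
have : hypot R (1 + ey) (2 + false) + 5^-1 <= hypot R (1 + ey) (2 + true).
  by rewrite hypotC [leRHS]hypotC; apply: hypot_gap_near; case: ey.
rewrite /= !addn0; lra.
Qed.

Lemma broom_value_y (R : rcfType) (n k j : nat) (ec ex : bool) :
  (23 <= n)%N -> (j.+1 <= n - 4)%N ->
  broom_value R n k j.+1 ec ex false < broom_value R n k j ec ex true.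
Proof.
move=> n23 jn; rewrite /broom_value mul0r mul1r -natr1.
have -> : (n - 4 - j)%:R = (n - 4 - j.+1)%:R + 1 :> R by rewrite natr1; congr _%:R; lia.
have H20 : (20 <= n - 3 + ec)%N by lia.
have := hypot_gap_far R H20; move: (n - 3 + ec)%N {H20} => H.
have : hypot R (1 + false) (2 + ex) + 5^-1 <= hypot R (1 + true) (2 + ex).
  by apply: hypot_gap_near; case: ex.
rewrite /= !addn0; lra.
Qed.

Lemma broom_value_max (R : rcfType) (n k : nat) : (4 <= k)%N -> (k < n)%N ->
  broom_value R n k (k - 3) true true true = Qprime_bound R n k.
Proof.
move=> k4 kn; rewrite /broom_value /Qprime_bound (hypotC _ 2 3).
have -> : (n - 3 + true)%N = (n - 2)%N by rewrite /=; lia.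
have -> : (n - 4 - (k - 3))%:R = n%:R - k%:R - 1 :> R.
  by rewrite -addrA -opprD natr1 -natrB //; congr _%:R; lia.
have -> : (k - 3)%:R = k%:R - 3 :> R by rewrite natrB // ltnW.
rewrite /=; ring.
Qed.

(** Each false flag means one more ordinary leaf adjacent to [u], so [j] exceeds [k - 3] by the
    number of false flags, and that many exchanges reach the maximum. *)
Lemma broom_value_lt (R : rcfType) (n k j : nat) (ec ex ey : bool) :
  (23 <= n)%N -> (4 <= k)%N -> (k < n)%N -> (j <= n - 4)%N -> (j + ec + ex + ey = k)%N ->
  ~~ [&& ec, ex & ey] -> broom_value R n k j ec ex ey < Qprime_bound R n k.
Proof.
move=> n23 k4 kn jn; rewrite -broom_value_max //.
have [k3 n5] : (2 < k)%N /\ (5 < n)%N by lia.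
have incr_c i ex' ey' : (i < n - 4)%N -> _ := broom_value_center R ex' ey' k3 n5.
have incr_x i ec' ey' : (i < n - 4)%N -> _ := broom_value_x R k ec' ey' n23.
have incr_y i ec' ex' : (i < n - 4)%N -> _ := broom_value_y R k ec' ex' n23.
case: ec; case: ex; case: ey => //= jk _.
- rewrite (_ : j = (k - 3).+1) in jn *; last by lia.
  exact: incr_y.
- rewrite (_ : j = (k - 3).+1) in jn *; last by lia.
  exact: incr_x.
- rewrite (_ : j = (k - 3).+2) in jn *; last by lia.
  by apply: lt_trans (incr_x _ _ _ jn) (incr_y _ _ _ (ltnW jn)).
- rewrite (_ : j = (k - 3).+1) in jn *; last by lia.
  exact: incr_c.
- rewrite (_ : j = (k - 3).+2) in jn *; last by lia.
  by apply: lt_trans (incr_c _ _ _ jn) (incr_y _ _ _ (ltnW jn)).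
- rewrite (_ : j = (k - 3).+2) in jn *; last by lia.
  by apply: lt_trans (incr_c _ _ _ jn) (incr_x _ _ _ (ltnW jn)).
- rewrite (_ : j = (k - 3).+3) in jn *; last by lia.
  apply: lt_trans (incr_c _ _ _ jn) _.
  by apply: lt_trans (incr_x _ _ _ (ltnW jn)) (incr_y _ _ _ (ltnW (ltnW jn))).
Qed.

(** * Recognizing [Qprime] as the extremal broom *)

Lemma broom_iso (G : sgraph) (n : nat) (u c x y : G) :
  #|G| = n -> (4 <= n)%N -> broom_at u c x y -> adj u c -> adj u x -> adj u y ->
  isomorphic G (Qprime n (degree u)).
Proof.
move=> nG n4 br ac ax ay; have [us adjE yE] := br.
have := broom_degree br; rewrite ac ax ay.
set P := [set v | (v \notin _) && _] => dP.
pose P' := [set v | (v \notin [:: u; c; x; y]) && ~~ adj u v].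
have PP' : (#|P| + #|P'| = n - 4)%N.
  rewrite -nG -(card_broom_leaves br).
  rewrite -(cardsID [set v | adj u v] [set v | v \notin [:: u; c; x; y]]).
  by congr (_ + _)%N; apply: eq_card => v; rewrite !inE // andbC.
(* [x] stands at position 1 because [Qprime] attaches its last vertex, here [y], to leaf 1. *)
pose t := c :: x :: (enum P ++ enum P').
have sz : size t = (n - 1 - 1)%N by rewrite /= size_cat -!cardE; lia.
have [[cu xu yu] [xc yc xy]] : [/\ c != u, x != u & y != u] /\ [/\ x != c, y != c & x != y].
  move: us; rewrite /= !inE !negb_or !(eq_sym u) !(eq_sym c).
  by move=> /and4P[/and3P[-> -> ->] /andP[-> ->] -> _].
have t_uniq : uniq t.
  rewrite /= !inE !mem_cat !mem_enum !inE !eqxx !orbT /= orbF eq_sym xc /=.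
  rewrite cat_uniq !enum_uniq andbT /=.
  by apply/hasPn => v; rewrite !mem_enum !inE => /andP[-> /negbTE->].
have t_out v : v \in t -> (v != u) && (v != y).
  rewrite !inE mem_cat !mem_enum !inE !negb_or.
  by case/or4P => [/eqP->|/eqP->|/andP[/and4P[-> _ _ ->]]|/andP[/and4P[-> _ _ ->]]] //;
    rewrite ?cu ?xu ?xy // eq_sym.
have nthu (i : 'I_(n - 1 - 1)) : nth u t i != u.
  by have /t_out/andP[] : nth u t i \in t by rewrite mem_nth ?sz.
have nthy (i : 'I_(n - 1 - 1)) : nth u t i != y.
  by have /t_out/andP[] : nth u t i \in t by rewrite mem_nth ?sz.
have nthc (i : 'I_(n - 1 - 1)) : (nth u t i == c) = (i == 0%N :> nat).
  by apply: (@nth_uniq _ u t i 0) => //; rewrite sz //; lia.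
have nthx (i : 'I_(n - 1 - 1)) : (nth u t i == x) = (i == 1%N :> nat).
  by apply: (@nth_uniq _ u t i 1) => //; rewrite sz //; lia.
have nthP (i : 'I_(n - 1 - 1)) : adj u (nth u t i) = (i < degree u - 1)%N.
  (* Apart from [y], the neighbours of [u] are [c], [x] and the members of [P], which fill the first
     positions of [t]. *)
  have -> : (degree u - 1 = #|P|.+2)%N by rewrite dP !addn1 subn1.
  case: i => [[|[|i]] lt]; [by rewrite /= ac | by rewrite /= ax | rewrite /= !ltnS].
  apply: nth_enum_cat => [v|v|]; rewrite ?inE ?PP'; try by case/andP.
  by move: lt; clear; lia.
pose h (z : Qprime n (degree u)) : G := match z with
  | None => y
  | Some None => u
  | Some (Some i) => nth u t (i : 'I_(n - 1 - 1)) end.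
apply: (@iso_of_inj _ _ h).
- move=> [[i|]|] [[j|]|] //= E.
  + by do 2!congr Some; apply: val_inj; move/eqP: E; rewrite nth_uniq ?sz // => /eqP.
  + by have := nthu i; rewrite E eqxx.
  + by have := nthy i; rewrite E eqxx.
  + by have := nthu j; rewrite -E eqxx.
  + by have := yu; rewrite E eqxx.
  + by have := nthy j; rewrite -E eqxx.
  + by have := yu; rewrite E eqxx.
- by rewrite !card_option card_ord nG; clear -n4; lia.
- move=> [[i|]|] [[j|]|] /=; rewrite ?inE ?adj_irr //.
  + by rewrite adjE ?nthu ?nthy // !nthc.
  + by rewrite adj_sym nthP.
  + by rewrite adj_sym yE ?nthu // nthx.
  + by rewrite yE ?nthu // nthx.
  + by rewrite adj_sym.
Qed.

Lemma card_ord_lt (m a : nat) : (a <= m)%N -> #|[set i : 'I_m | (i < a)%N]| = a.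
Proof.
move=> am; rewrite -[RHS]card_ord -(@card_imset _ _ (widen_ord am)); last first.
  by move=> i j /(congr1 val) /= ij; apply: val_inj.
apply: eq_card => i; rewrite inE; apply/idP/imsetP => [ia|[j _ ->]] /=; last exact: ltn_ord.
by exists (Ordinal ia) => //; apply: val_inj.
Qed.

(** This makes [broom_sombor] applicable to [Qprime] itself, so its index needs no separate
    computation. *)
Lemma Qprime_broom (n k : nat) : (4 <= k)%N -> (k < n)%N ->
  exists u c x y : Qprime n k,
    [/\ broom_at u c x y, [&& adj u c, adj u x & adj u y] & degree u = k].
Proof.
move=> k4 kn.
have m0 : (0 < n - 1 - 1)%N by lia.
have m1 : (1 < n - 1 - 1)%N by lia.
pose u : Qprime n k := Some None; pose y : Qprime n k := None.
pose c : Qprime n k := Some (Some (Ordinal m0)).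
pose x : Qprime n k := Some (Some (Ordinal m1)).
exists u, c, x, y; split.
- split=> //.
  + by move=> [[i|]|] [[j|]|].
  + by move=> [[i|]|] //= _; rewrite inE.
- rewrite /= !inE /=; lia.
pose D := [set i : 'I_(n - 1 - 1) | (i < k - 1)%N].
have -> : degree u = #|y |: [set (Some (Some i) : Qprime n k) | i in D]|.
  apply: eq_card => -[[i|]|]; rewrite !inE //=.
  - by rewrite mem_imset ?inE // => ? ? [].
  - by apply/esym/negbTE/imsetP => -[].
  - by rewrite inE.
rewrite cardsU1 card_imset; last by move=> ? ? [].
rewrite card_ord_lt; last by lia.
rewrite (_ : y \notin _); first by lia.
by apply/imsetP => -[].
Qed.

Lemma Qprime_sombor (R : rcfType) (n k : nat) : (4 <= k)%N -> (k < n)%N ->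
  sombor R (Qprime n k) = Qprime_bound R n k.
Proof.
move=> k4 kn; have [u [c [x [y [br /and3P[ac ax ay] dk]]]]] := Qprime_broom k4 kn.
have cardQ : #|Qprime n k| = n by rewrite !card_option card_ord; lia.
have [j [jk _] ->] := broom_sombor br R cardQ dk.
by move: jk; rewrite ac ax ay -broom_value_max // => jk; congr broom_value; lia.
Qed.

Theorem theorem3p3 (R : rcfType) (n k : nat) (G : sgraph)
  (hn : (23 <= n)%N) (hk4 : (4 <= k)%N) (hkn : (k <= n - 2)%N)
  (hG : in_Q n k G)
  (hQ : ~ isomorphic G (Qgraph n k)) (hQs : ~ isomorphic G (Qstar n k)) :
  let N : R := n%:R in
  let K : R := k%:R in
  let bound : R :=
    (K - 2) * Num.sqrt (K ^+ 2 + 4)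
    + (K - 3) * Num.sqrt ((N - 2) ^+ 2 + 4)
    + (N - K - 1) * Num.sqrt ((N - 2) ^+ 2 + 1)
    + Num.sqrt (K ^+ 2 + (N - 2) ^+ 2)
    + Num.sqrt ((N - 2) ^+ 2 + 9)
    + Num.sqrt (K ^+ 2 + 9)
    + Num.sqrt 13 in
  sombor R G <= bound /\ (sombor R G = bound <-> isomorphic G (Qprime n k)).
Proof.
move=> N K bound; have kn : (k < n)%N by lia.
have {bound}-> : bound = Qprime_bound R n k.
  rewrite /bound /Qprime_bound /hypot natrB; last by lia.
  do !congr (_ + _); do ?congr (_ * _); congr Num.sqrt; rewrite /N /K; ring.
(* This dichotomy yields both the bound and the equality case, since [Qprime] attains the bound and
   the index is invariant under isomorphism. *)
suff main : sombor R G < Qprime_bound R n k \/ isomorphic G (Qprime n k).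
  have isoE : isomorphic G (Qprime n k) -> sombor R G = Qprime_bound R n k.
    by move/(sombor_iso R) ->; apply: Qprime_sombor.
  case: main => [lt|iso]; last by split; [rewrite isoE | split].
  split; first exact: ltW.
  by split => [E|/isoE//]; rewrite E ltxx in lt.
have [_ nG [u [T dk]]] := hG.
have [n3 n2] : (3 < n)%N /\ (2 < n)%N by lia.
case: (boolP [exists c, (c != u) && (n - 3 <= tdeg u c)%N]) => [/existsP[c /andP[cu]]|]; last first.
  rewrite negb_exists => /forallP low; left; apply: (sombor_lt_low_tdeg R hn (ltnW hk4) kn nG T dk).
  by move=> v vu; have := low v; rewrite vu /= -ltnNge.
case: (leqP (n - 2) (tdeg u c)) => [hub _|lt ge].
  by have := star_iso nG (hub_star nG T n2 cu hub); rewrite dk => -[/hQ|/hQs].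
have [x [y br]] : exists x y, broom_at u c x y by apply: (hub_broom nG T n2 cu); lia.
case: (boolP [&& adj u c, adj u x & adj u y]) => [/and3P[ac ax ay]|nall].
  by right; rewrite -dk; apply: (broom_iso nG _ br ac ax ay); lia.
left; have [j [jk jn] ->] := broom_sombor br R nG dk.
exact: broom_value_lt.
Qed.
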